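(* Let $K$ be a field, $S=K[x_1,\ldots,x_n]$, and let $I\subset S$ be a monomial ideal with linear quotients. Then there is a degree increasing admissible order of $G(I)$, i.e. an admissible order $u_1,\ldots,u_m$ of $G(I)$ such that $\deg u_i\le \deg u_{i+1}$ for $i=1,\ldots,m-1$.
   Context: For a monomial ideal $I$, $G(I)$ denotes its unique minimal set of monomial generators. An ordering $u_1,\ldots,u_m$ of $G(I)$ is called an admissible order if for each $i=2,\ldots,m$ the colon ideal $(u_1,\ldots,u_{i-1}):u_i$ is generated by a subset of the variables $\{x_1,\ldots,x_n\}$. $I$ has linear quotients if $G(I)$ has an admissible order. *)

(* Defs.v *)
From mathcomp Require Import all_boot all_algebra.
From mathcomp Require Export mpoly.

Set Implicit Arguments.
Unset Strict Implicit.
Unset Printing Implicit Defensive.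

Import GRing.Theory.
Local Open Scope ring_scope.

(* Ideals are [Prop]-valued predicates compared extensionally: the [idealr] of
   ring_quotient is decidable and proper, which excludes the unit ideal. *)
Definition ideal_eq (R : comNzRingType) (I J : R -> Prop) : Prop :=
  forall f : R, I f <-> J f.

(* The finite combinations \sum_i a_i * g_i with all the g_i in A; each pair is
   (a_i, g_i), and A may be empty or infinite. *)
Definition ideal_gen (R : comNzRingType) (A : R -> Prop) (f : R) : Prop :=
  exists s : seq (R * R),
    (forall p, p \in s -> A p.2) /\ f = \sum_(p <- s) p.1 * p.2.

Definition colon_ideal (R : comNzRingType) (I : R -> Prop) (u f : R) : Prop :=
  I (f * u).

Section MonomialIdeals.
Variables (K : fieldType) (n : nat).
Implicit Types (I : {mpoly K[n]} -> Prop) (G H : 'X_{1..n} -> Prop).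

(* Monomials are identified with their exponents in 'X_{1..n}. *)
Definition monomial_gen G : {mpoly K[n]} -> Prop :=
  ideal_gen (fun f : {mpoly K[n]} => exists2 m : 'X_{1..n}, G m & f = 'X_[m]).

Definition variable_gen (V : {set 'I_n}) : {mpoly K[n]} -> Prop :=
  ideal_gen (fun f : {mpoly K[n]} => exists2 i : 'I_n, i \in V & f = 'X_i).

Definition monomial_ideal I : Prop :=
  exists G, ideal_eq I (monomial_gen G).

(* G is G(I). *)
Definition minimal_monomial_gens I G : Prop :=
  ideal_eq I (monomial_gen G) /\
  forall H, (forall m, H m -> G m) -> ideal_eq I (monomial_gen H) ->
    forall m, G m -> H m.

Definition ordering_of_gens I (u : seq 'X_{1..n}) : Prop :=
  uniq u /\ minimal_monomial_gens I (fun m => m \in u).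

(* 0-based indexing: [take i u] lists the generators preceding [nth 0%MM u i]. *)
Definition admissible_order I (u : seq 'X_{1..n}) : Prop :=
  ordering_of_gens I u /\
  forall i : nat, (0 < i < size u)%N ->
    exists V : {set 'I_n},
      ideal_eq
        (colon_ideal (monomial_gen (fun m => m \in take i u)) 'X_[nth 0%MM u i])
        (variable_gen V).

Definition linear_quotients I : Prop :=
  exists u : seq 'X_{1..n}, admissible_order I u.

End MonomialIdeals.

(* Main.v *)
Require Import Defs.
From mathcomp Require Import all_boot all_algebra.
From mathcomp Require Import mpoly.
From mathcomp Require Import zify.

(** An ordering u_1, ..., u_m of an antichain of monomials is admissible iff for
    all j < i there are k < i and a variable x_d such that u_k divides x_d u_i
    and x_d divides u_j : u_i.  Induct on m: reorder u_1, ..., u_(m-1) by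
    increasing degree and insert x = u_m after the last generator of degree at
    most deg x.  The witnesses u_k for x satisfy deg u_k <= deg x, because u_k
    divides x_d x and is not a multiple of x; so they still precede x.  For w of
    degree > deg x, take the witness u_k, x_d for the pair (w, x): then u_k : w
    divides x : w, and the witness for the pair (u_k, w) also serves (x, w). *)

Set Implicit Arguments.
Unset Strict Implicit.
Unset Printing Implicit Defensive.

(** * Closure properties of generated ideals *)

Section IdealGen.
Variable R : GRing.ComNzRing.type.
Implicit Types (A : R -> Prop) (f g a : R).
Local Open Scope ring_scope.

Lemma ideal_gen0 A : ideal_gen A 0.
Proof. by exists [::]; split=> //; rewrite big_nil. Qed.

Lemma ideal_genD A f g : ideal_gen A f -> ideal_gen A g -> ideal_gen A (f + g).
Proof.
move=> [s [hs ->]] [t [ht ->]]; exists (s ++ t); split; last by rewrite big_cat.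
by move=> p; rewrite mem_cat => /orP[/hs|/ht].
Qed.

Lemma ideal_gen_mull A a g : A g -> ideal_gen A (a * g).
Proof.
move=> Ag; exists [:: (a, g)]; split; last by rewrite big_seq1.
by move=> p; rewrite inE => /eqP ->.
Qed.

End IdealGen.

(** * Reordering exponent vectors by degree *)

Section LinearQuotients.
Variable n : nat.
Implicit Types (v w x k : 'X_{1..n}) (s t u : seq 'X_{1..n}).

(** Combinatorial form of [(s) : w] being generated by variables: [x_d] lies in the colon and
    divides [v / gcd(v, w)]. *)
Definition linear_colon s w : Prop :=
  forall v, v \in s -> exists2 k, k \in s &
    exists2 d : 'I_n, (k <= w + U_(d))%MM & w d < v d.

(** Index 0 is harmless: its prefix is empty. *)
Definition linear_order u : Prop :=
  forall i, i < size u -> linear_colon (take i u) (nth 0%MM u i).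

Definition antichain s : Prop :=
  forall v w, v \in s -> w \in s -> (v <= w)%MM -> v = w.

Lemma lepm_mdeg_eq v w : (v <= w)%MM -> mdeg w <= mdeg v -> v = w.
Proof.
move=> /submK vw; rewrite -{1}vw mdegD => le_wv.
have /eqP : mdeg (w - v) = 0 by lia.
by rewrite mdeg_eq0 => /eqP w0; rewrite -vw w0 add0m.
Qed.

Lemma lepm_DU k w (d : 'I_n) i :
  (k <= w + U_(d))%MM -> k i <= w i + (d == i).
Proof. by move=> /mnm_lepP /(_ i); rewrite mnmDE mnm1E. Qed.

Lemma linear_order_rcons u x :
  linear_order (rcons u x) -> linear_order u /\ linear_colon u x.
Proof.
move=> lux; split=> [i iu|].
  have := lux i; rewrite size_rcons ltnS nth_rcons iu -cats1 takel_cat ?(ltnW iu) //.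
  exact.
have := lux (size u); rewrite size_rcons ltnSn nth_rcons ltnn eqxx -cats1.
by rewrite take_size_cat //; apply.
Qed.

(** A divisor of [x + U_(d)] of degree above [mdeg x] is [x + U_(d)] itself, a multiple of [x]. *)
Lemma mdeg_divisor_DU k x d :
  (k <= x + U_(d))%MM -> ~~ (x <= k)%MM -> mdeg k <= mdeg x.
Proof.
move=> kxd; apply: contraNT; rewrite -ltnNge => xk.
suff -> : k = (x + U_(d))%MM by apply: lem_addr.
by apply: (lepm_mdeg_eq kxd); rewrite mdegD mdeg1 addn1.
Qed.

(** Only [k] is confined to [s]; [v] may lie in [t], which is what inserting [x] before [t]
    requires. *)
Lemma linear_colon_prefix s t x :
  {in s ++ t, forall v, ~~ (x <= v)%MM} ->
  {in t, forall v, mdeg x < mdeg v} ->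
  linear_colon (s ++ t) x ->
  {in s ++ t, forall v, exists2 k, k \in s &
    exists2 d : 'I_n, (k <= x + U_(d))%MM & x d < v d}.
Proof.
move=> ndiv degt lx v /lx [k kst [d kxd xv]].
exists k; last by exists d.
have := kst; rewrite mem_cat => /orP[//|/degt].
by rewrite ltnNge (mdeg_divisor_DU kxd) // ndiv.
Qed.

Lemma linear_colon_insert s t w x k d :
  linear_colon (s ++ t) w -> k \in s -> (k <= x + U_(d))%MM -> x d < w d ->
  linear_colon (s ++ x :: t) w.
Proof.
move=> lw ks kxd xw.
have sub v : v \in s ++ t -> v \in s ++ x :: t.
  by rewrite !mem_cat inE => /orP[] ->; rewrite ?orbT.
move=> v; rewrite mem_cat inE orbCA -mem_cat => /orP[/eqP ->|/lw[l /sub]]; last by exists l.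
have [|l /sub ls [e lwe we]] := lw k; first by rewrite mem_cat ks.
exists l => //; exists e => //.
(* If [e = d], then [k d <= x d + 1 <= w d] contradicts [w d < k d]. Otherwise [k e <= x e], hence
   [w e < x e]. *)
have := lepm_DU e kxd; move: we; case: eqP => [<-|_]; lia.
Qed.

Lemma linear_order_insert s t x :
  {in s ++ t, forall v, ~~ (x <= v)%MM} ->
  {in t, forall v, mdeg x < mdeg v} ->
  linear_order (s ++ t) -> linear_colon (s ++ t) x ->
  linear_order (s ++ x :: t).
Proof.
move=> ndiv degt lst lx i; rewrite size_cat /= addnS ltnS => ist.
have wit := linear_colon_prefix ndiv degt lx.
have [lt_is|lt_si|->] := ltngtP i (size s).
- have := lst i; rewrite size_cat !takel_cat ?(ltnW lt_is) // !nth_cat lt_is.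
  by apply; lia.
(* Past [x] indices shift by one: the generator now at [i] is [nth 0%MM t j], formerly at
   [size s + j]. *)
- have [j Ei] : exists j, i = size s + j.+1 by exists (i - size s).-1; lia.
  have jt : j < size t by lia.
  have := lst (size s + j); rewrite size_cat ltn_add2l => /(_ jt).
  rewrite Ei !take_cat !nth_cat !ltnNge !leq_addr !addKn /= => lw.
  have [|k ks [d kxd xw]] := wit (nth 0%MM t j).
    by rewrite mem_cat mem_nth ?orbT.
  exact: linear_colon_insert lw ks kxd xw.
- rewrite take_size_cat // nth_cat ltnn subnn /= => v vs.
  by apply: wit; rewrite mem_cat vs.
Qed.

Lemma pairwise_mdeg_split d u : pairwise (relpre mdeg leq) u ->
  exists s t, [/\ u = s ++ t, {in s, forall v, mdeg v <= d}
                & {in t, forall v, d < mdeg v}].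
Proof.
elim: u => [|x u IHu] /=; first by exists [::], [::].
move=> /andP[/allP xu /IHu[s [t [Eu sd td]]]]; rewrite {}Eu in xu *.
have [xd|dx] := leqP (mdeg x) d.
  exists (x :: s), t; split=> // v; rewrite inE => /orP[/eqP ->//|]; exact: sd.
exists [::], (x :: s ++ t); split=> // v; rewrite inE => /orP[/eqP ->//|/xu /=].
exact: leq_trans.
Qed.

Lemma linear_order_mdeg_sort u : uniq u -> antichain u -> linear_order u ->
  exists s, [/\ perm_eq s u, linear_order s & pairwise (relpre mdeg leq) s].
Proof.
elim/last_ind: u => [|u x IHu]; first by exists [::].
rewrite rcons_uniq => /andP[xNu uniq_u] anti /linear_order_rcons[lu lx].
have subu v : v \in u -> v \in rcons u x by rewrite mem_rcons inE orbC => ->.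
have [|s [pu ls ss]] := IHu uniq_u _ lu.
  by move=> v w /subu ? /subu; apply: anti.
have [a [b [Es da db]]] := pairwise_mdeg_split (mdeg x) ss.
rewrite {s}Es in pu ls ss; exists (a ++ x :: b); split.
- by rewrite perm_catC /= perm_sym perm_rcons perm_sym perm_cons perm_catC.
- apply: linear_order_insert => //.
    (* If [x] divided some [v] in [u], the antichain property would give [x = v], a repetition. *)
    move=> v; rewrite (perm_mem pu) => vu; apply: contraNN xNu => /anti ->//.
    + by rewrite mem_rcons mem_head.
    + exact: subu.
  (* [linear_colon] depends only on the set of preceding generators, so sorting them preserves
     it. *)
  move=> v; rewrite (perm_mem pu) => /lx[k ku dP].
  by exists k; rewrite ?(perm_mem pu).
move: ss; rewrite !pairwise_cat /= => /and3P[ab -> ->]; rewrite andbT allrel_consr ab.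
rewrite andbT; apply/andP; split; apply/allP => v; first exact: da.
by move/db/ltnW.
Qed.

End LinearQuotients.

(** * Translation between ideals and exponents *)

Section MonomialIdeals.
Variables (K : fieldType) (n : nat).
Implicit Types (G : 'X_{1..n} -> Prop) (f : {mpoly K[n]}) (m v w : 'X_{1..n}).
Implicit Types (s u : seq 'X_{1..n}) (I : {mpoly K[n]} -> Prop).
Local Open Scope ring_scope.

(** Multiplying by ['X_[g]] shifts the support by [g]; conversely, [f] is the sum of its terms. *)
Lemma monomial_genP G f : monomial_gen G f <->
  forall m, m \in msupp f -> exists2 g, G g & (g <= m)%MM.
Proof.
split=> [[s [sG ->]] m /msupp_sum_le /flattenP[ms /mapP[p]]|Gf].
  rewrite mem_filter => /= /sG[g Gg ->] ->.
  by rewrite (perm_mem (msuppMX _ _)) => /mapP[m' _ ->]; exists g; rewrite ?lem_addr.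
rewrite [f]mpolyE big_seq; apply: big_ind => [||m mf].
- exact: ideal_gen0.
- exact: ideal_genD.
have [g Gg /submK <-] := Gf m mf.
by rewrite mpolyXD -mul_mpolyC GRing.mulrA; apply: ideal_gen_mull; exists g.
Qed.

Lemma monomial_gen_monomialP G m : monomial_gen G 'X_[K, m] <->
  exists2 g, G g & (g <= m)%MM.
Proof.
rewrite monomial_genP; split=> [|Gm m']; first by apply; rewrite msuppX mem_head.
by rewrite msuppX inE => /eqP ->.
Qed.

Lemma variable_genP (V : {set 'I_n}) f : variable_gen V f <->
  forall m, m \in msupp f -> exists2 i, i \in V & (m i > 0)%N.
Proof.
have -> : variable_gen V f <->
    monomial_gen (fun m => exists2 i, i \in V & m = U_(i)%MM) f.
  split=> -[s [sV ->]]; exists s; split=> // p /sV.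
    by case=> i iV ->; exists U_(i)%MM => //; exists i.
  by case=> _ [i iV ->] ->; exists i.
rewrite monomial_genP; split=> Vf m /Vf.
  by case=> _ [i iV ->]; rewrite lep1mP -lt0n; exists i.
by case=> i iV; rewrite lt0n -lep1mP; exists U_(i)%MM => //; exists i.
Qed.

Lemma colon_monomial_genP G w f : colon_ideal (monomial_gen G) 'X_[w] f <->
  forall m, m \in msupp f -> exists2 g, G g & (g <= w + m)%MM.
Proof.
rewrite /colon_ideal monomial_genP; split=> Gf m.
  by move=> mf; apply: Gf; rewrite (perm_mem (msuppMX _ _)) map_f.
by rewrite (perm_mem (msuppMX _ _)) => /mapP[m' /Gf ? ->].
Qed.

Lemma linear_colonP s w :
  (exists V : {set 'I_n},
     ideal_eq (colon_ideal (monomial_gen (fun m => m \in s)) 'X_[K, w])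
              (variable_gen V))
  <-> linear_colon s w.
Proof.
split=> [[V eqV] v vs|lw].
  (* Truncated subtraction makes [v - w] the exponent of [v / gcd(v, w)], which lies in the
     colon. *)
  have /eqV/variable_genP /(_ (v - w)%MM) :
      colon_ideal (monomial_gen (fun m => m \in s)) 'X_[w] 'X_[K, v - w].
    apply/colon_monomial_genP => m; rewrite msuppX inE => /eqP ->.
    by exists v => //; apply/mnm_lepP => i; rewrite !mnmE; lia.
  rewrite msuppX mem_head => /(_ isT)[d dV]; rewrite mnmBE subn_gt0 => wv.
  have /eqV/colon_monomial_genP /(_ U_(d)%MM) : variable_gen V 'X_[K, U_(d)].
    apply/variable_genP => m; rewrite msuppX inE => /eqP ->.
    by exists d => //; rewrite mnm1E eqxx.
  by rewrite msuppX mem_head => /(_ isT)[k ks kwd]; exists k => //; exists d.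
(* All variables lying in the colon. *)
exists [set d | has (fun k => (k <= w + U_(d))%MM) s] => f.
rewrite colon_monomial_genP variable_genP; split=> sf m /sf.
  case=> v /lw[k ks [d kwd wv]] /mnm_lepP /(_ d); rewrite mnmDE => vwm.
  by exists d; [rewrite inE; apply/hasP; exists k | lia].
case=> d; rewrite inE => /hasP[k ks kwd] md; exists k => //.
apply: lepm_trans kwd _; apply/mnm_lepP => i; rewrite !mnmE.
by case: eqP => [<-|]; lia.
Qed.

(** If [v] properly divided [w], removing [w] would leave the ideal unchanged, against
    minimality. *)
Lemma minimal_monomial_gens_antichain I s :
  minimal_monomial_gens I (fun m => m \in s) -> antichain s.
Proof.
move=> [eqI minI] v w vs ws vw; apply/eqP/negPn/negP => neq_vw.
have [||_] := minI (fun m => m \in s /\ m != w) _ _ w ws; last by rewrite eqxx.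
  by move=> m [].
move=> f; rewrite eqI !monomial_genP; split=> sf m /sf[g].
  move=> gs gm; have [gw|] := eqVneq g w; last by exists g.
  by exists v => //; apply: lepm_trans vw _; rewrite -gw.
by case=> gs _ gm; exists g.
Qed.

Lemma admissible_linear_order I u : admissible_order I u -> linear_order u.
Proof.
move=> [_ adm] [|i] iu; first by rewrite take0.
by apply/linear_colonP; apply: adm.
Qed.

End MonomialIdeals.

Theorem lemma2p1 (K : fieldType) (n : nat) (I : {mpoly K[n]} -> Prop)
    (hI : monomial_ideal I) (hlq : linear_quotients I) :
  exists u : seq 'X_{1..n},
    admissible_order I u /\
    (forall i : nat, (i.+1 < size u)%N ->
       (mdeg (nth 0%MM u i) <= mdeg (nth 0%MM u i.+1))%N).
Proof.
have [u adm] := hlq; have [[uniq_u minI] _] := adm.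
have [s [su ls ss]] := linear_order_mdeg_sort uniq_u
  (minimal_monomial_gens_antichain minI) (admissible_linear_order adm).
exists s; split; last first.
  move=> i si; apply: (pairwiseP 0%MM ss) => //.
  by rewrite inE (ltn_trans _ si).
split; last by move=> i /andP[_ /ls /linear_colonP]; apply.
split; first by rewrite (perm_uniq su).
have sE m : (m \in s) = (m \in u) := perm_mem su m.
(* The ideal and minimality depend only on the set of generators, so both pass from [u] to [s]. *)
have gensE f : monomial_gen (fun m => m \in s) f <-> monomial_gen (fun m => m \in u) f.
  by rewrite !monomial_genP; split=> h m /h[g gs gm]; exists g => //; rewrite -?sE // sE.
have [eqI mini] := minI; split=> [f|H sH eqH m]; first by rewrite eqI gensE.
by rewrite sE; apply: mini => // m' /sH; rewrite sE.
Qed.
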